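(* Let $A=(a_{ij})\in\mathbb{R}^{n\times m}$, let $N=\{1,\dots,n\}$, $M=\{1,\dots,m\}$, and let $p\ge 1$. Let $G_R$ be the complete undirected graph on the node set $N$ (the rows of $A$), with edge weights $$\omega^{VN}_{ik}=2\sum_{j\in M}|a_{ij}-a_{kj}|^p\qquad (i,k\in N,\ i\ne k),$$ and let $G_C$ be the complete undirected graph on the node set $M$ (the columns of $A$), with edge weights $$\tau^{VN}_{j\ell}=2\sum_{i\in N}|a_{ij}-a_{i\ell}|^p\qquad (j,\ell\in M,\ j\ne \ell).$$ Then the stress seriation problem for $A$ under the von Neumann neighborhood is equivalent to finding two minimum weight Hamiltonian paths, one in $(G_R,\omega^{VN})$ and one in $(G_C,\tau^{VN})$. That is, a pair of permutations $(\sigma_r,\sigma_c)\in\mathcal{P}_n\times\mathcal{P}_m$ is an optimal solution of the stress seriation problem for $A$ under the von Neumann neighborhood if and only if the Hamiltonian path induced by $\sigma_r$ has minimum weight among all Hamiltonian paths of $(G_R,\omega^{VN})$ and the Hamiltonian path induced by $\sigma_c$ has minimum weight among all Hamiltonian paths of $(G_C,\tau^{VN})$.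
   Context: $\mathcal{P}_n$ and $\mathcal{P}_m$ denote the sets of permutations of $N=\{1,\dots,n\}$ and $M=\{1,\dots,m\}$. For $\sigma_r\in\mathcal{P}_n$ and $\sigma_c\in\mathcal{P}_m$, $\sigma_r(i)=k$ means that row $i$ of $A$ is placed in position $k$, and $\sigma_c(j)=\ell$ means that column $j$ of $A$ is placed in position $\ell$. Thus in the reordered matrix $A_{\sigma_r,\sigma_c}$ the entry in position $(\sigma_r(i),\sigma_c(j))$ is $a_{ij}$. The row and column permutations are chosen independently. The von Neumann neighborhood of a position $(i,j)\in N\times M$ is $$\mathcal{N}_{ij}=\{(k,\ell)\in N\times M:\ \|(k,\ell)-(i,j)\|_2\le 1\},$$ i.e. $(i,j)$ itself together with those of $(i\pm1,j)$, $(i,j\pm1)$ that lie in $N\times M$. The stress of entry $(i,j)$ is $$S^{\ell_p}_{ij}(\sigma_r,\sigma_c)=\sum_{(k,\ell)\in N\times M:\ (\sigma_r(k),\sigma_c(\ell))\in\mathcal{N}_{\sigma_r(i)\sigma_c(j)}}|a_{ij}-a_{k\ell}|^p ,$$ i.e. the entry is compared with its neighbors in the reordered matrix. The stress seriation problem for $A$ is $$\min_{\sigma_r\in\mathcal{P}_n,\ \sigma_c\in\mathcal{P}_m}\ \sum_{i\in N}\sum_{j\in M}S^{\ell_p}_{ij}(\sigma_r,\sigma_c).$$ A Hamiltonian path in a graph is a path visiting every vertex exactly once; its weight is the sum of the weights of its edges. The Hamiltonian path induced by a permutation $\sigma$ of $\{1,\dots,s\}$ is the path visiting the nodes in the order $\sigma^{-1}(1),\sigma^{-1}(2),\dots,\sigma^{-1}(s)$.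 *)

(* Defs.v *)
From HB Require Import structures.
From mathcomp Require Import all_boot all_order all_algebra all_fingroup.
From mathcomp Require Import reals exp.

Set Implicit Arguments.
Unset Strict Implicit.
Unset Printing Implicit Defensive.

Import Order.TTheory GRing.Theory Num.Theory.

Local Open Scope ring_scope.

(* Rows, columns and positions are numbered from 0, i.e. N is 'I_n and M is
   'I_m; only differences of indices matter below. A permutation sends a row
   (column) to the position where it is placed. *)

Definition euclid_dist (R : realType) (n m : nat) (x y : 'I_n * 'I_m) : R :=
  Num.sqrt ((x.1%:R - y.1%:R) ^+ 2 + (x.2%:R - y.2%:R) ^+ 2).

Definition von_neumann (R : realType) (n m : nat) (x : 'I_n * 'I_m) :
    {set 'I_n * 'I_m} :=
  [set y | euclid_dist R y x <= 1].

Definition stress (R : realType) (n m : nat) (A : 'M[R]_(n, m)) (p : R)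
    (sr : {perm 'I_n}) (sc : {perm 'I_m}) (i : 'I_n) (j : 'I_m) : R :=
  \sum_(kl : 'I_n * 'I_m |
          (sr kl.1, sc kl.2) \in von_neumann R (sr i, sc j))
    `|A i j - A kl.1 kl.2| `^ p.

Definition total_stress (R : realType) (n m : nat) (A : 'M[R]_(n, m)) (p : R)
    (sr : {perm 'I_n}) (sc : {perm 'I_m}) : R :=
  \sum_(i < n) \sum_(j < m) stress A p sr sc i j.

Definition stress_optimal (R : realType) (n m : nat) (A : 'M[R]_(n, m)) (p : R)
    (sr : {perm 'I_n}) (sc : {perm 'I_m}) : Prop :=
  forall (sr' : {perm 'I_n}) (sc' : {perm 'I_m}),
    total_stress A p sr sc <= total_stress A p sr' sc'.

(* Undirected weighted graph; only the values of weight on edges matter. *)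
Record wgraph (R : realType) (T : finType) := WGraph {
  adj : rel T;
  weight : T -> T -> R;
  adj_sym : symmetric adj;
  adj_irr : irreflexive adj;
  weight_sym : forall x y, weight x y = weight y x }.

Lemma neq_sym (T : eqType) : symmetric (fun x y : T => x != y).
Proof. by move=> x y; rewrite eq_sym. Qed.

Lemma neq_irr (T : eqType) : irreflexive (fun x y : T => x != y).
Proof. by move=> x; rewrite eqxx. Qed.

Definition complete_wgraph (R : realType) (T : finType) (w : T -> T -> R)
    (w_sym : forall x y, w x y = w y x) : wgraph R T :=
  WGraph (@neq_sym T) (@neq_irr T) w_sym.

(* A path is the sequence of its vertices; the empty sequence is the
   Hamiltonian path of the graph without vertices. *)
Definition hamiltonian_path (R : realType) (T : finType) (G : wgraph R T)
    (s : seq T) : Prop :=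
  [/\ sorted (adj G) s, uniq s & forall x : T, x \in s].

Definition path_weight (R : realType) (T : finType) (G : wgraph R T)
    (s : seq T) : R :=
  \sum_(e <- zip s (behead s)) weight G e.1 e.2.

Definition min_hamiltonian_path (R : realType) (T : finType) (G : wgraph R T)
    (s : seq T) : Prop :=
  hamiltonian_path G s /\
  forall s' : seq T, hamiltonian_path G s' -> path_weight G s <= path_weight G s'.

Definition induced_path (n : nat) (sigma : {perm 'I_n}) : seq 'I_n :=
  [seq (sigma^-1)%g k | k <- enum 'I_n].

Definition omegaVN (R : realType) (n m : nat) (A : 'M[R]_(n, m)) (p : R)
    (i k : 'I_n) : R :=
  2 * \sum_(j < m) `|A i j - A k j| `^ p.

Definition tauVN (R : realType) (n m : nat) (A : 'M[R]_(n, m)) (p : R)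
    (j l : 'I_m) : R :=
  2 * \sum_(i < n) `|A i j - A i l| `^ p.

Lemma omegaVN_sym (R : realType) (n m : nat) (A : 'M[R]_(n, m)) (p : R)
    (i k : 'I_n) :
  omegaVN A p i k = omegaVN A p k i.
Proof. by congr (2 * _); apply: eq_bigr => j _; rewrite distrC. Qed.

Lemma tauVN_sym (R : realType) (n m : nat) (A : 'M[R]_(n, m)) (p : R)
    (j l : 'I_m) :
  tauVN A p j l = tauVN A p l j.
Proof. by congr (2 * _); apply: eq_bigr => i _; rewrite distrC. Qed.

Definition row_graph (R : realType) (n m : nat) (A : 'M[R]_(n, m)) (p : R) :
    wgraph R 'I_n :=
  complete_wgraph (omegaVN_sym A p).

Definition col_graph (R : realType) (n m : nat) (A : 'M[R]_(n, m)) (p : R) :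
    wgraph R 'I_m :=
  complete_wgraph (tauVN_sym A p).

(* Main.v *)
Require Import Defs.
From mathcomp Require Import all_boot all_order all_algebra all_fingroup.
From mathcomp Require Import reals exp.
From mathcomp Require Import zify.

Import Order.TTheory GRing.Theory Num.Theory.
Local Open Scope ring_scope.

(** The total stress separates into a function of the row order plus a function
    of the column order.  At grid points the Euclidean unit ball consists of
    the centre and its horizontal and vertical neighbors ([von_neumannE]).  The
    centre contributes [0 `^ p = 0].  A vertical neighbor lies in the same
    column and in a row placed next to that of the centre, so that summing over
    the columns leaves, for each ordered pair of consecutive rows [i] and [k],
    the sum over [j] of [`|A i j - A k j| `^ p].  Every edge of the row path
    occurs as two ordered pairs, which is the factor 2 in the edge weights;
    columns behave in the same way.  This gives [total_stress_path_weight]: the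
    total stress is the weight of the induced row path plus the weight of the
    induced column path.

    Since the two permutations are chosen independently, such a sum is minimal
    exactly when both summands are.  Finally, every Hamiltonian path of a
    complete graph is induced by some permutation ([induced_path_surj]), so
    minimality over permutations is minimality over Hamiltonian paths. *)

(** * The von Neumann neighborhood *)

Definition consecutive (a b : nat) : bool := (a.+1 == b) || (b.+1 == a).

Lemma consecutive_irr : irreflexive consecutive.
Proof. by move=> a; rewrite /consecutive; lia. Qed.

(** The squared distance of two grid points is a natural number, and a sum of
    two squares of naturals is at most 1 only if one of them is 0 and the other
    is 0 or 1. *)
Lemma von_neumannE (R : realType) (n m : nat) (x y : 'I_n * 'I_m) :
  (y \in von_neumann R x) =
  (y.1 == x.1) && ((y.2 == x.2) || consecutive x.2 y.2)
  || consecutive x.1 y.1 && (y.2 == x.2).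
Proof.
have sqr_dist (a b : nat) :
    (a%:R - b%:R) ^+ 2 = (((a - b) + (b - a)) ^ 2)%N%:R :> R.
  wlog le_ba : a b / (b <= a)%N => [sym|].
    case/orP: (leq_total b a) => /sym // Eab.
    by rewrite -sqrrN opprB Eab addnC.
  have -> : (b - a = 0)%N by apply/eqP.
  by rewrite addn0 -natrB // natrX.
rewrite inE /euclid_dist -[leRHS]sqrtr1 ler_sqrt // !sqr_dist -natrD.
rewrite -[leRHS]/(1%:R) ler_nat /consecutive -!val_eqE /=.
move: (val x.1) (val x.2) (val y.1) (val y.2) => a b c d.
have sum_sqr_le1 (u v : nat) : (u ^ 2 + v ^ 2 <= 1)%N = (u + v <= 1)%N.
  by case: u v => [|[|u]] [|[|v]] //; apply/idP/idP; nia.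
by rewrite sum_sqr_le1; lia.
Qed.

(** The centre of the neighborhood has no term on the right-hand side: it
    contributes [0 `^ p], which vanishes because [p] is nonzero. *)
Lemma stressE (R : realType) (n m : nat) (A : 'M[R]_(n, m)) (p : R)
    (sr : {perm 'I_n}) (sc : {perm 'I_m}) (i : 'I_n) (j : 'I_m) :
  p != 0 ->
  stress A p sr sc i j =
    \sum_(k | consecutive (sr i) (sr k)) `|A i j - A k j| `^ p +
    \sum_(l | consecutive (sc j) (sc l)) `|A i j - A i l| `^ p.
Proof.
move=> p_neq0; rewrite /stress (bigID (fun kl => kl.1 == i)) /= addrC.
congr (_ + _).
  rewrite (eq_bigl
    (fun kl => consecutive (sr i) (sr kl.1) && (kl.2 == j))); last first.
    move=> [k l]; rewrite von_neumannE /= !(inj_eq perm_inj).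
    by case: eqP => [->|_]; rewrite ?consecutive_irr ?andbF ?andbT.
  rewrite -(pair_big_dep (fun k => consecutive (sr i) (sr k))
    (fun _ l => l == j) (fun k l => `|A i j - A k l| `^ p)) /=.
  by apply: eq_bigr => k _; rewrite big_pred1_eq.
rewrite (eq_bigl (fun kl =>
  (kl.1 == i) && ((kl.2 == j) || consecutive (sc j) (sc kl.2)))); last first.
  move=> [k l]; rewrite von_neumannE /= !(inj_eq perm_inj).
  by case: eqP => [->|_]; rewrite ?consecutive_irr ?orbF ?andbF ?andbT.
rewrite -(pair_big_dep (fun k => k == i)
  (fun _ l => (l == j) || consecutive (sc j) (sc l))
  (fun k l => `|A i j - A k l| `^ p)) /= big_pred1_eq (bigD1 j) ?eqxx //=.
rewrite subrr normr0 powR0 // add0r; apply: eq_bigl => l.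
by case: eqP => [->|_]; rewrite ?consecutive_irr ?andbF ?andbT.
Qed.

(** * Paths induced by permutations *)

Lemma big_zip_behead (R : realType) (T : Type) (x0 : T) (F : T -> T -> R)
    (s : seq T) :
  \sum_(e <- zip s (behead s)) F e.1 e.2 =
  \sum_(i < (size s).-1) F (nth x0 s i) (nth x0 s i.+1).
Proof.
case: s => [|x s] /=; first by rewrite big_nil big_ord0.
elim: s x => [|y s IHs] x /=; first by rewrite big_nil big_ord0.
by rewrite big_cons big_ord_recl IHs.
Qed.

Lemma path_weight_induced (R : realType) (n : nat) (G : wgraph R 'I_n)
    (s : {perm 'I_n}) :
  path_weight G (induced_path s) =
  \sum_i \sum_(k | (s i).+1 == s k :> nat) weight G i k.
Proof.
case: n G s => [|n] G s.
  rewrite big_ord0 /path_weight /induced_path.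
  by rewrite [enum _](size0nil _) ?size_enum_ord // big_nil.
(* Once the vertices are indexed by position, both sides run over positions. *)
rewrite (reindex_inj (@perm_inj _ (s^-1)%g)) /=.
rewrite /path_weight (big_zip_behead _ _ ord0) size_map size_enum_ord /=.
(* The vertex in the last position has no successor. *)
rewrite big_ord_recr /= [X in _ + X]big_pred0 ?addr0; last first.
  by move=> k; rewrite permKV /= eqn_leq ltnNge -ltnS ltn_ord.
apply: eq_bigr => i _.
have nth_path (k : 'I_n.+1) :
    nth ord0 (induced_path s) k = (s^-1)%g k.
  by rewrite (nth_map ord0) ?size_enum_ord // nth_ord_enum.
rewrite (nth_path (widen_ord (leqnSn n) i)).
rewrite -[i.+1]/(bump 0 i) (nth_path (lift ord0 i)).
rewrite (big_pred1 ((s^-1)%g (lift ord0 i))) // => k.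
by rewrite permKV /= -(inj_eq (@perm_inj _ s)) permKV -val_eqE eq_sym.
Qed.

(** Each edge of the path is seen once from either end. *)
Lemma sum_consecutive_path_weight (R : realType) (n : nat) (G : wgraph R 'I_n)
    (s : {perm 'I_n}) :
  \sum_i \sum_(k | consecutive (s i) (s k)) weight G i k =
  2 * path_weight G (induced_path s).
Proof.
rewrite mulr_natl mulr2n path_weight_induced.
rewrite [X in _ = _ + X](exchange_big_dep xpredT) //= -big_split /=.
apply: eq_bigr => i _.
rewrite (bigID (fun k => (s i).+1 == s k :> nat)) /=.
congr (_ + _).
  by apply: eq_bigl => k; rewrite /consecutive; lia.
apply: eq_big => [k|k _]; last exact: weight_sym.
by rewrite /consecutive; lia.
Qed.

Lemma complete_hamiltonianP (R : realType) (T : finType) (w : T -> T -> R)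
    (w_sym : forall x y, w x y = w y x) (s : seq T) :
  hamiltonian_path (complete_wgraph w_sym) s <->
  uniq s /\ forall x, x \in s.
Proof.
split=> [[]|[s_uniq s_all]] //; split=> //=.
by apply: pairwise_sorted; rewrite -uniq_pairwise.
Qed.

Lemma induced_path_hamiltonian (R : realType) (n : nat) (w : 'I_n -> 'I_n -> R)
    (w_sym : forall x y, w x y = w y x) (s : {perm 'I_n}) :
  hamiltonian_path (complete_wgraph w_sym) (induced_path s).
Proof.
apply/complete_hamiltonianP; split=> [|x].
  by rewrite (map_inj_uniq (@perm_inj _ _)) enum_uniq.
by apply/mapP; exists (s x); rewrite ?mem_enum ?permK.
Qed.

(** The permutation that sends each vertex to its position in the sequence
    induces the sequence; it is built as the inverse of the enumeration. *)
Lemma induced_path_surj (n : nat) (s : seq 'I_n) :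
  uniq s -> (forall x, x \in s) ->
  exists sigma : {perm 'I_n}, s = induced_path sigma.
Proof.
move=> s_uniq s_all.
have size_s : size s == n.
  by rewrite -(card_uniqP s_uniq) (eq_card (B := 'I_n)) ?card_ord.
have t_inj : injective (tnth (Tuple size_s)) by apply/tuple_uniqP.
exists ((perm t_inj)^-1)%g; rewrite /induced_path invgK.
rewrite (eq_map (permE t_inj)).
by rewrite map_tnth_enum.
Qed.

Lemma min_hamiltonian_induced (R : realType) (n : nat) (w : 'I_n -> 'I_n -> R)
    (w_sym : forall x y, w x y = w y x) (s : {perm 'I_n}) :
  let G := complete_wgraph w_sym in
  min_hamiltonian_path G (induced_path s) <->
  forall s' : {perm 'I_n},
    path_weight G (induced_path s) <= path_weight G (induced_path s').
Proof.
split=> [[_ s_min] s'|s_min].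
  exact/s_min/induced_path_hamiltonian.
split=> [|t /complete_hamiltonianP[t_uniq t_all]].
  exact: induced_path_hamiltonian.
by have [s' ->] := induced_path_surj _ t t_uniq t_all.
Qed.

(** * Separation of the total stress *)

Lemma total_stress_path_weight (R : realType) (n m : nat) (A : 'M[R]_(n, m))
    (p : R) (sr : {perm 'I_n}) (sc : {perm 'I_m}) :
  p != 0 ->
  total_stress A p sr sc =
  path_weight (row_graph A p) (induced_path sr) +
  path_weight (col_graph A p) (induced_path sc).
Proof.
move=> p_neq0; apply: (@mulfI _ 2); first by rewrite pnatr_eq0.
rewrite mulrDr -!sum_consecutive_path_weight /= /total_stress.
rewrite (eq_bigr _ (fun i _ => eq_bigr _ (fun j _ =>
  @stressE R n m A p sr sc i j p_neq0))).
rewrite (eq_bigr _ (fun i _ => big_split _ _ _ _ _)) /= big_split mulrDr /=; congr (_ + _).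
  rewrite mulr_sumr; apply: eq_bigr => i _.
  by rewrite exchange_big mulr_sumr.
rewrite exchange_big mulr_sumr; apply: eq_bigr => j _.
by rewrite exchange_big mulr_sumr.
Qed.

Theorem theorem1 (R : realType) (n m : nat) (A : 'M[R]_(n, m)) (p : R)
    (hp : 1 <= p) (sr : {perm 'I_n}) (sc : {perm 'I_m}) :
  stress_optimal A p sr sc <->
  min_hamiltonian_path (row_graph A p) (induced_path sr) /\
  min_hamiltonian_path (col_graph A p) (induced_path sc).
Proof.
have p_neq0 : p != 0 by rewrite gt_eqF // (lt_le_trans ltr01).
rewrite !min_hamiltonian_induced; split=> [opt|[min_r min_c] sr' sc'].
  split=> [sr'|sc'].
    by have := opt sr' sc; rewrite !total_stress_path_weight // lerD2r.
  by have := opt sr sc'; rewrite !total_stress_path_weight // lerD2l.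
by rewrite !total_stress_path_weight // lerD.
Qed.
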